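(* Let $K$ be a compact Hausdorff space such that $K^{(2)}\neq\emptyset$. Then $$d_{\rm BM}\big(C(K),C[0,\omega]\big)\ \ge\ 2+\sqrt5 .$$
   Context: All compact spaces are Hausdorff. $C(K)$ is the Banach space of real-valued continuous functions on $K$ with the supremum norm. $[0,\omega]$ is the ordinal interval $\omega+1$ with the order topology, i.e. a convergent sequence together with its limit; $C[0,\omega]$ denotes $C([0,\omega])$. $K^{(n)}$ denotes the $n$-th Cantor–Bendixson derivative: $K^{(0)}=K$ and $K^{(n+1)}$ is the set of non-isolated points of $K^{(n)}$. For Banach spaces $X,Y$, an isomorphism is a bounded linear bijection (with bounded inverse), and $d_{\rm BM}(X,Y)=\inf\{\|T\|\cdot\|T^{-1}\| : T:X\to Y \text{ an isomorphism}\}$, with $d_{\rm BM}(X,Y)=\infty$ if $X$ and $Y$ are not isomorphic. *)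

(* Defs.v *)
From HB Require Import structures.
From mathcomp Require Import all_boot all_order all_algebra.
From mathcomp Require Import all_classical all_reals all_analysis lra.

Set Implicit Arguments.
Unset Strict Implicit.
Unset Printing Implicit Defensive.

Import Order.TTheory GRing.Theory Num.Theory.
Import numFieldTopology.Exports numFieldNormedType.Exports.

Local Open Scope classical_set_scope.
Local Open Scope ring_scope.

HB.mixin Record isCompactHausdorff T & Topological T := {
  compact_space : compact [set: T];
  hausdorff_spaceT : hausdorff_space T
}.

#[short(type="compactHausdorffType")]
HB.structure Definition CompactHausdorff :=
  {T of Topological T & isCompactHausdorff T}.

(* `isolated A` is relative to A. *)
Definition cantor_bendixson {K : topologicalType} (n : nat) : set K :=
  iter n (fun A : set K => A `\` isolated A) [set: K].

(* An alias, so that the sup norm does not clash with the topologies on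
   `continuousType` provided by the ArrowAs* modules. *)
Definition C (R : realType) (K : topologicalType) : Type := continuousType K R.

Section C_lmodType.
Context {R : realType} {K : topologicalType}.

Definition continuous_pred : {pred K -> R} := mem [set f : K -> R | continuous f].

Section Sub.
Context (f : K -> R) (fP : f \in continuous_pred).
Definition C_Sub_subproof := @isContinuous.Build K R f (set_mem fP).
#[local] HB.instance Definition _ := C_Sub_subproof.
Definition C_Sub : C R K := [the continuousType K R of f].
End Sub.

Definition C_val (f : C R K) : K -> R := f.

Lemma C_rect (P : C R K -> Type) :
  (forall f (Pf : f \in continuous_pred), P (C_Sub Pf)) -> forall u, P u.
Proof.
move=> Psub [f [[cf]]].
have Pf : f \in continuous_pred by exact: mem_set.
have -> : cf = set_mem Pf by exact: Prop_irrelevance.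
exact: Psub.
Qed.

Lemma C_SubK f (Pf : f \in continuous_pred) : C_val (C_Sub Pf) = f.
Proof. by []. Qed.

HB.instance Definition _ := isSub.Build _ _ (C R K) C_rect C_SubK.
HB.instance Definition _ := [Choice of C R K by <:].

Lemma continuous_submod_closed : submod_closed continuous_pred.
Proof.
split; first by apply/mem_set => x; exact: cvg_cst.
move=> a f g /set_mem /= cf /set_mem /= cg; apply/mem_set => /= x.
by apply: cvgD; [apply: cvgZl_tmp; exact: cf | exact: cg].
Qed.

HB.instance Definition _ :=
  GRing.isSubmodClosed.Build _ _ continuous_pred continuous_submod_closed.
HB.instance Definition _ := [SubChoice_isSubLmodule of C R K by <:].

End C_lmodType.

Section C_normedMod.
Context {R : realType} {K : compactHausdorffType}.
Implicit Types f g : C R K.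

(* If K is empty then so is the range, and `sup set0 = 0`. *)
Definition supnorm f : R := sup (range (fun x => `|f x|)).

Lemma supnorm_has_ubound f : has_ubound (range (fun x => `|f x|)).
Proof.
have cf : compact (range (fun x => `|f x|)).
  apply: continuous_compact; last exact: compact_space.
  apply: continuous_subspaceT => x.
  by apply: cvg_norm; exact: (@cts_fun _ _ (f : continuousType K R)).
have [M [_ MA]] := compact_bounded cf.
by exists (M + 1) => y /MA My; rewrite (le_trans _ (My _ _)) ?ler_norm ?ltrDl.
Qed.

Lemma supnorm_ub f x : `|f x| <= supnorm f.
Proof. by apply: ub_le_sup; [exact: supnorm_has_ubound|exists x]. Qed.

Lemma supnorm_ge0 f : 0 <= supnorm f.
Proof.
rewrite /supnorm.
have [->|/set0P[_ [x _ _]]] := eqVneq (range (fun x => `|f x|)) set0.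
  by rewrite sup0.
by rewrite (le_trans _ (supnorm_ub f x)).
Qed.

Lemma supnorm_le f e : 0 <= e -> (forall x, `|f x| <= e) -> supnorm f <= e.
Proof.
move=> e0 fe; rewrite /supnorm.
have [->|/set0P A0] := eqVneq (range (fun x => `|f x|)) set0.
  by rewrite sup0.
by apply: ge_sup => // _ [x _ <-].
Qed.

Lemma supnormD f g : supnorm (f + g) <= supnorm f + supnorm g.
Proof.
apply: supnorm_le; first by rewrite addr_ge0 ?supnorm_ge0.
by move=> x; rewrite (le_trans (ler_normD _ _))// lerD ?supnorm_ub.
Qed.

Lemma supnormZ (a : R) f : supnorm (a *: f) = `|a| * supnorm f.
Proof.
have le b h : supnorm (b *: h) <= `|b| * supnorm h.
  apply: supnorm_le; first by rewrite mulr_ge0 ?supnorm_ge0.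
  by move=> x; rewrite [leLHS]normrM ler_wpM2l ?supnorm_ub.
apply/eqP; rewrite eq_le le/=.
have [->|a0] := eqVneq a 0; first by rewrite normr0 mul0r supnorm_ge0.
rewrite -ler_pdivlMl ?normr_gt0//.
by rewrite -normfV (le_trans _ (le _ _))// scalerA mulVf// scale1r.
Qed.

Lemma supnorm0_eq0 f : supnorm f = 0 -> f = 0.
Proof.
move=> f0; apply/val_inj/funext => x; apply/normr0_eq0/le_anti.
by rewrite normr_ge0 andbT -f0 supnorm_ub.
Qed.

HB.instance Definition _ :=
  Lmodule_isNormed.Build R (C R K) supnormD supnormZ supnorm0_eq0.

Lemma C_normE f : `|f| = sup (range (fun x => `|f x|)).
Proof. by []. Qed.

Lemma C_complete (F : set_system (C R K)) :
  ProperFilter F -> cauchy F -> cvg F.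
Proof.
move=> FF /cauchy_ballP Fc.
pose l x := lim ((fun f : C R K => f x) @ F).
have FU (e : R) : 0 < e -> exists2 U : set (C R K), F U &
    forall f g, U f -> U g -> forall x, `|f x - g x| < e.
  move=> /Fc /= [[U V]/= [FU FV] UV]; exists (U `&` V); first exact: filterI.
  move=> f g [Uf _] [_ Vg] x; have := UV (f, g) (conj Uf Vg).
  rewrite /= -ball_normE /ball_/=; apply: le_lt_trans.
  exact: (supnorm_ub (f - g)).
have Fl x : (fun f : C R K => f x) @ F --> l x.
  apply: cauchy_cvg; apply/cauchy_ballP => e /FU[U FU' Ue].
  exists ((fun f : C R K => f x) @` U, (fun f : C R K => f x) @` U) => /=.
    have ? : F ((fun f : C R K => f x) @^-1` ((fun f : C R K => f x) @` U)).
      by apply: filterS FU' => f Uf; exists f.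
    by split.
  by move=> [_ _] /= [[f Uf <-] [g Ug <-]]; rewrite -ball_normE; exact: Ue.
have unif (e : R) : 0 < e -> F [set f : C R K | forall x, `|l x - f x| <= e].
  move=> /FU[U FU' Ue]; apply: filterS (FU') => f Uf x.
  have : (fun g : C R K => `|g x - f x|) @ F --> `|l x - f x|.
    by apply: cvg_norm; apply: cvgB => //; exact: cvg_cst.
  by move/cvgr_to_le; apply; apply: filterS FU' => g Ug; exact/ltW/Ue.
have cl : continuous l.
  move=> x; apply/cvgrPdist_le => /= e e0.
  have e3 : 0 < e / 3 by rewrite divr_gt0.
  have [f lf] := filter_ex (unif _ e3).
  have cf : continuous f by exact: cts_fun.
  have /cvgrPdist_le/(_ _ e3) := cf x; apply: filterS => y fxy.
  have -> : l x - l y = (l x - f x) + (f x - f y) + (f y - l y).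
    by rewrite !subrKA.
  have -> : e = e / 3 + e / 3 + e / 3 by lra.
  rewrite (le_trans (ler_normD _ _))// lerD ?(distrC (f y))//.
  by rewrite (le_trans (ler_normD _ _))// lerD.
apply/cvg_ex; exists (C_Sub (mem_set cl)).
apply/cvgrPdist_le => /= e e0; apply: filterS (unif _ e0) => f lf.
by apply: supnorm_le => //; exact: ltW.
Qed.

HB.instance Definition _ := Uniform_isComplete.Build (C R K) C_complete.

End C_normedMod.

(* The ordinal omega + 1: `Some n` is the ordinal n and `None` is omega. *)
Definition succ_omega : Type := option nat.

HB.instance Definition _ := Choice.on succ_omega.

Section succ_omega_order.
Implicit Types x y z : succ_omega.

Definition le_succ_omega x y : bool :=
  match x, y with
  | Some m, Some n => (m <= n)%N
  | _, None => true
  | None, Some _ => false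
  end.

Lemma le_succ_omega_refl : reflexive le_succ_omega.
Proof. by case=> //= n. Qed.

Lemma le_succ_omega_anti : antisymmetric le_succ_omega.
Proof. by case=> [m|] [n|] //= /anti_leq ->. Qed.

Lemma le_succ_omega_trans : transitive le_succ_omega.
Proof. by case=> [n|] [m|] [p|] //=; exact: leq_trans. Qed.

Lemma le_succ_omega_total : total le_succ_omega.
Proof. by case=> [m|] [n|] //=; exact: leq_total. Qed.

HB.instance Definition _ := Order.Le_isPOrder.Build Order.default_display succ_omega
  le_succ_omega_refl le_succ_omega_anti le_succ_omega_trans.
HB.instance Definition _ :=
  Order.POrder_isTotal.Build Order.default_display succ_omega le_succ_omega_total.

End succ_omega_order.

Local Notation interval_omega := (order_topology succ_omega).

Lemma succ_omega_compact : compact [set: interval_omega].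
Proof.
have ltE (x y : interval_omega) : (x < y)%O = ~~ le_succ_omega y x by rewrite ltNge.
apply/compact_near_coveringP => I F P FF cov.
have [[U V] /= [U0 FV] UV] := cov (None : interval_omega) Logic.I.
have [n nU] : exists n, forall m, (n < m)%N -> U (Some m).
  move: U0; rewrite itv_nbhsE => -[[l r] [oi xi] sU].
  have {oi xi} : exists n, forall m, (n < m)%N ->
      (Some m : interval_omega) \in Interval l r.
    case: l r oi xi {sU} => [[] l|[]] [[] r|[]] //= _;
      rewrite in_itv/= ?andbT ?ltE.
    - by case: r => [r|]; rewrite andbF.
    - case: l => // n _; exists n => m nm.
      by rewrite in_itv/= andbT ltE/= -ltnNge.
    - by case: r.
    - by exists 0%N => m _; rewrite in_itv.
  by move=> [n nlr]; exists n => m /nlr; exact: sU.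
have FM m : F [set i | (m <= n)%N -> P i (Some m)].
  have [[U' V'] /= [U'm FV'] UV'] := cov (Some m : interval_omega) Logic.I.
  apply: filterS FV' => i V'i _.
  by apply: (UV' (Some m : interval_omega, i)); split => //; exact: nbhs_singleton.
have /= FN : F [set i | forall m : 'I_n.+1, P i (Some (m : nat))].
  apply: filter_forall => m; apply: filterS (FM m) => i; apply.
  by rewrite -ltnS ltn_ord.
apply: filterS2 FV FN => i Vi Pi [m|] _; last first.
  by apply: (UV (None : interval_omega, i)); split => //; exact: nbhs_singleton.
have [mn|nm] := leqP m n; first by have := Pi (Ordinal (mn : (m < n.+1)%N)).
by apply: (UV (Some m : interval_omega, i)); split => //; exact: nU.
Qed.

HB.instance Definition _ :=
  isCompactHausdorff.Build interval_omega succ_omega_compact order_hausdorff.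

Section banach_mazur.
Local Open Scope ereal_scope.
Context {R : realType}.

Definition opnorm {X Y : normedModType R} (T : {linear X -> Y}) : \bar R :=
  ereal_sup [set `|T x|%:E | x in [set x | (`|x| <= 1)%R]].

Definition bounded_linear {X Y : normedModType R} (T : {linear X -> Y}) :=
  opnorm T < +oo.

Definition isomorphism {X Y : normedModType R}
    (T : {linear X -> Y}) (S : {linear Y -> X}) :=
  [/\ bounded_linear T, bounded_linear S, cancel T S & cancel S T].

(* S is the inverse of T; the infimum is +oo when X and Y are not isomorphic,
   since `ereal_inf set0 = +oo`. *)
Definition d_BM (X Y : completeNormedModType R) : \bar R :=
  ereal_inf [set r | exists (T : {linear X -> Y}) (S : {linear Y -> X}),
    isomorphism T S /\ r = opnorm T * opnorm S].

End banach_mazur.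

(* Main.v *)
Require Import Defs.
From HB Require Import structures.
From mathcomp Require Import all_boot all_order all_algebra.
From mathcomp Require Import all_classical all_reals all_analysis.
From mathcomp Require Import ring lra.

Import Order.TTheory GRing.Theory Num.Theory.
Import numFieldTopology.Exports numFieldNormedType.Exports.

Local Open Scope classical_set_scope.
Local Open Scope ring_scope.

(** Let [T] be an isomorphism from C(K) to C[0,omega], scaled so that
    [|h| <= |T h| <= M |h|] for all [h], where [M] is the product of the norms
    of [T] and its inverse.  As [M] is positive, the claim M >= 2 + sqrt 5
    amounts to M^2 - 4M - 1 >= 0.  Let [a] be the value at omega of [T 1],
    which may be taken nonnegative.

    The bounded functional [h |-> T h z] can only be large on few members of a
    family of bumps with disjoint supports.  The second derivative of K being
    nonempty, the first derivative is infinite, so that there is a bump [f]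
    around some non-isolated point whose image is small at omega and at the
    finitely many points of [0,omega] where [T 1] is not close to [a].  Every
    neighbourhood of that point is infinite, so inside the set where [f = 1]
    there is a further bump [g] whose image is small at the finitely many points
    where [T 1] is not close to [a] or [T f] is not close to 0.  Thus [0,omega]
    splits into three regions: in the first [T f] and [T g] are negligible, in
    the second [T 1] is about [a] and [T g] is negligible, in the third [T 1] is
    about [a] and [T f] is negligible.

    The functions [1 - 2f], [1 - 2g] and [1 - 2f + 2g] have norm at most 1.
    Their images are bounded by [M], which gives, up to a small error,
      -(M - a)/2 <= T f <= (M + a)/2   and   |T g| <= (M - a)/2
    in the second and third regions.  The positive combinations of [1], [f] and
    [g], on the other hand, have norm equal to the sum of their coefficients.
    With coefficients M + a, 2(M - a), 2(M + a) this yields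
    5M + a <= M(M + a), and with coefficients 0, M - a, M + a it yields
    4M <= M^2 - a^2.  The first inequality proves the claim when a <= 1, the
    second one when a >= 1.

    [small_bump] produces the bumps, [image_bound_of_three_terms] and
    [image_bound_of_two_terms] bound the two combinations from above, and
    [isomorphism_quadratic_bound] combines everything. *)

(** * Pointwise estimates *)

Section estimates.
Context {R : realFieldType}.

(** Here [t], [F], [G] are the values at one point of the images of [1], [f] and
    [g], and [a] is the value of the image of [1] at the limit point.  The
    first group of inequalities comes from the functions [1], [1 - 2f],
    [1 - 2g] and [1 - 2f + 2g] of norm at most 1; the disjunction lists the
    three regions, with error [e].  In the last one the error doubles, because
    [F] is close to the value at the limit point, which itself is only small. *)
Definition value_constraints (M a e t F G : R) :=
  [/\ 0 <= a, a <= M, 0 <= e & [/\ `|t| <= M, `|t - 2 * F| <= M,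
    `|t - 2 * G| <= M & `|t - 2 * F + 2 * G| <= M]] /\
  [\/ `|F| <= e /\ `|G| <= e, `|t - a| <= e /\ `|G| <= e
    | `|t - a| <= e /\ `|F| <= 2 * e].

(** The coefficients make the second and third regions contribute at most the
    bound [M (M + a)] that the first region forces: in the second region
    (M + a) a + 2 (M - a) (M + a)/2 = M (M + a), in the third
    (M + a) a + 2 (M + a) (M - a)/2 = M (M + a). *)
Lemma image_bound_of_three_terms M a e t F G : value_constraints M a e t F G ->
  `|(M + a) * t + 2 * (M - a) * F + 2 * (M + a) * G| <= M * (M + a) + 16 * M * e.
Proof.
move=> [[a0 aM e0 [tM tF tG tFG]] reg].
have sub: 0 <= M - a by lra.
have add: 0 <= M + a by lra.
have Me : 0 <= M * e by rewrite mulr_ge0//; lra.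
have ae : 0 <= a * e by rewrite mulr_ge0.
have ae' : 0 <= (M - a) * e by rewrite mulr_ge0.
have aa : 0 <= a * (M - a) by rewrite mulr_ge0.
have aa2 : 0 <= a * a by rewrite mulr_ge0.
move: tM tF tG tFG; rewrite !ler_norml.
move=> /andP[t1 t2] /andP[tF1 tF2] /andP[tG1 tG2] /andP[tFG1 tFG2].
case: reg => -[]; rewrite !ler_norml => /andP[h1 h2] /andP[h3 h4];
 apply/andP; split; nra.
Qed.

(** The coefficients balance the bounds (M + a)/2 on [F] and (M - a)/2 on [G]:
    the products are both (M^2 - a^2)/2. *)
Lemma image_bound_of_two_terms M a e t F G : value_constraints M a e t F G ->
  `|(M - a) * F + (M + a) * G| <= (M ^+ 2 - a ^+ 2) / 2 + 7 * M * e.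
Proof.
move=> [[a0 aM e0 [tM tF tG tFG]] reg].
have sub: 0 <= M - a by lra.
have add: 0 <= M + a by lra.
have Me : 0 <= M * e by rewrite mulr_ge0//; lra.
have ae : 0 <= a * e by rewrite mulr_ge0.
have ae' : 0 <= (M - a) * e by rewrite mulr_ge0.
have aa : 0 <= (M + a) * (M - a) by rewrite mulr_ge0.
move: tM tF tG tFG; rewrite !ler_norml.
move=> /andP[t1 t2] /andP[tF1 tF2] /andP[tG1 tG2] /andP[tFG1 tFG2].
case: reg => -[]; rewrite !ler_norml => /andP[h1 h2] /andP[h3 h4];
 apply/andP; split; nra.
Qed.
End estimates.

(** * Derived sets *)

Section limit_points.
Context {K : topologicalType}.

(** If only finitely many points of [A] were in [W], removing those different
    from [x], a closed set, would leave a neighbourhood isolating [x]. *)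
Lemma limit_point_infinite (A W : set K) (x : K) : hausdorff_space K ->
  (A `\` isolated A) x -> nbhs x W -> infinite_set (A `&` W).
Proof.
move=> hK [Ax nix] xW fAW; apply: nix; split; first exact: mem_set.
have cF : closed ((A `&` W) `\ x).
  apply: (accessible_finite_set_closed.1 (hausdorff_accessible hK)).
  exact: finite_setD.
exists (W `&` ~` ((A `&` W) `\ x)).
  apply: filterI => //; apply: open_nbhs_nbhs; split; first exact: closed_openC.
  by move=> [_]; exact.
apply/seteqP; split=> [y [[Wy ny] Ay]|_ ->] /=.
  by apply: contrapT => yx; apply: ny.
by split=> //; split; [exact: nbhs_singleton|move=> [_]; exact].
Qed.

End limit_points.

(** * Bumps with disjoint supports and small images *)

Lemma sumCE {R : realType} {K : topologicalType} (I : finType)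
    (h : I -> C R K) x :
  (\sum_i h i) x = \sum_i h i x.
Proof. exact: (big_morph (fun f : C R K => f x)). Qed.

Section bumps.
Context {R : realType} {K : compactHausdorffType}.

Let normalK : normal_space K.
Proof. by apply: compact_normal; [exact: hausdorff_spaceT|exact: compact_space]. Qed.

(** By induction on [n]: the value at the new point is corrected by a multiple of
    a Urysohn function vanishing off [W] and at the earlier points. *)
Lemma interpolating_function (W : set K) (p : nat -> K) (n : nat) :
  open W -> injective p -> (forall i, W (p i)) ->
  exists u : K -> R, [/\ continuous u, forall x, ~ W x -> u x = 0 &
    forall i, (i < n)%N -> u (p i) = i.+1%:R].
Proof.
move=> oW pI Wp; elim: n => [|n [u [cu u0 up]]].
  by exists (fun=> 0); split=> // x; exact: cvg_cst.
have acc := hausdorff_accessible (@hausdorff_spaceT K).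
pose B := ~` W `|` p @` `I_n.
have cB : closed B.
  apply: closedU; first exact: open_closedC.
  apply: (accessible_finite_set_closed.1 acc).
  by apply: finite_image; exact: finite_II.
have Bp : B `&` [set p n] = set0.
  rewrite -subset0 => x [] /[swap] /= -> [/(_ (Wp n))//|[k /= kn /pI nk]].
  by move: kn; rewrite nk ltnn.
have sep := (@normal_separatorP R K).1 normalK B [set p n] cB
  (@accessible_closed_set1 _ acc (p n)) Bp.
pose w : K -> R := Urysohn B [set p n].
have w0 x : B x -> w x = 0 by move=> Bx; apply: (@Urysohn_sub0 _ R _ _ sep (w x)); exists x.
have w1 : w (p n) = 1 by apply: (@Urysohn_sub1 _ R _ _ sep (w (p n))); exists (p n).
exists (fun x => u x + (n.+1%:R - u (p n)) * w x); split.
- move=> x; apply: cvgD; first exact: cu.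
  by apply: cvgM; [exact: cvg_cst|exact: Urysohn_continuous].
- by move=> x Wx; rewrite u0// w0 ?mulr0 ?addr0//; left.
- move=> i; rewrite ltnS leq_eqVlt => /predU1P[->|lt_in].
    by rewrite w1 mulr1 addrC subrK.
  by rewrite up// w0 ?mulr0 ?addr0//; right; exists i.
Qed.

Definition tent (t : R) : R := Num.max 0 (Num.min 1 (2 - 4 * `|t|)).

Lemma tent_continuous : continuous tent.
Proof.
move=> t; pose g (x : R) := 2 - 4 * `|x|.
have cg : {for t, continuous g}.
  apply: cvgB; first exact: cvg_cst.
  by apply: cvgM; [exact: cvg_cst|apply: cvg_norm; exact: cvg_id].
have c0 (c : R) : {for t, continuous (fun=> c)} by exact: cvg_cst.
exact: (continuous_max (c0 0) (continuous_min (c0 1) cg)).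
Qed.

Lemma tent_ge0 t : 0 <= tent t.
Proof. by rewrite /tent le_max lexx. Qed.

Lemma tent_le1 t : tent t <= 1.
Proof. by rewrite /tent ge_max ler01/= ge_min lexx. Qed.

Lemma tent_eq0 t : 1 / 2 <= `|t| -> tent t = 0.
Proof. by move=> t2; rewrite /tent max_l// ge_min; apply/orP; right; lra. Qed.

Lemma tent_eq1 t : `|t| <= 1 / 4 -> tent t = 1.
Proof. by move=> t2; rewrite /tent min_l ?max_r//; lra. Qed.

(** A single function taking the values 1, ..., n at n points of [A] suffices: the
    bumps are its compositions with translates of [tent], whose supports are
    disjoint intervals.  The values start at 1 because the interpolating
    function is 0 off [W], where all the bumps have to vanish. *)
Lemma disjoint_bumps (A W : set K) (n : nat) :
    open W -> A `<=` W -> infinite_set A ->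
  exists (p : 'I_n -> K) (f : 'I_n -> C R K),
  [/\ forall i, A (p i), forall i x, 0 <= f i x <= 1,
      forall i, \forall x \near p i, f i x = 1,
      forall i x, ~ W x -> f i x = 0 &
      forall i j x, f i x != 0 -> f j x != 0 -> i = j].
Proof.
move=> oW AW /infiniteP/card_leP[h].
pose p (i : nat) : K := set_val (h (SigSub (mem_set (Logic.I : [set: nat] i)))).
have pI : injective p.
  move=> i j /val_inj /(@inj _ _ _ h).
  by rewrite !inE => /(_ Logic.I Logic.I)[].
have Ap i : A (p i) by exact: set_mem (valP _).
have [u [cu u0 up]] := interpolating_function W p n oW pI (fun i => AW _ (Ap i)).
have ct i : continuous (fun x => tent (u x - i.+1%:R)).
  move=> x; apply: (@continuous_comp _ _ _ (fun x => u x - i.+1%:R) tent);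
    last exact: tent_continuous.
  by apply: cvgB; [exact: cu|exact: cvg_cst].
exists (fun i => p i), (fun i : 'I_n => C_Sub (mem_set (ct i))); split.
- by [].
- by move=> i x; rewrite tent_ge0 tent_le1.
- move=> i; have /cvgrPdist_le/(_ (1/4)) := cu (p i).
  rewrite up// => /(_ ltac:(by rewrite divr_gt0)); apply: filterS => x hx.
  by apply: tent_eq1; rewrite distrC.
- move=> i x Wx; apply: tent_eq0; rewrite u0// sub0r normrN ger0_norm//.
  have : 1 <= i.+1%:R :> R by rewrite ler1n.
  lra.
- move=> i j x fi fj; apply/val_inj/eqP => /=.
  have near_k (k : 'I_n) : tent (u x - k.+1%:R) != 0 -> `|u x - k.+1%:R| < 1 / 2.
    by apply: contraNlt => /tent_eq0 ->.
  have : `|i.+1%:R - j.+1%:R| < 1 :> R.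
    have -> : i.+1%:R - j.+1%:R = (u x - j.+1%:R) - (u x - i.+1%:R) :> R by lra.
    apply: le_lt_trans (ler_normB _ _) _.
    by have := near_k _ fi; have := near_k _ fj; lra.
  rewrite ltNge; apply: contraNT => ij; apply: norm_intr_ge1.
    by rewrite rpredB// rpred_nat.
  by rewrite subr_eq0 eqr_nat eqSS.
Qed.

Context {L : compactHausdorffType}.

(** The sum of the [|T (f i) z|] is the value of [T] on a signed sum of the [f i],
    and such a sum has norm at most 1 because the supports are disjoint. *)
Lemma sum_disjoint_images (T : {linear C R K -> C R L}) (M : R) (n : nat)
    (f : 'I_n -> C R K) (z : L) :
    (forall h, `|T h| <= M * `|h|) -> 0 <= M ->
    (forall i x, 0 <= f i x <= 1) ->
    (forall i j x, f i x != 0 -> f j x != 0 -> i = j) ->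
  \sum_i `|T (f i) z| <= M.
Proof.
move=> TM M0 f01 fd.
pose h := \sum_i Num.sg (T (f i) z) *: f i.
have h1 : `|h| <= 1.
  apply: supnorm_le => // x; rewrite /h sumCE.
  have [[i fi]|nf] := pselect (exists i, f i x != 0).
    rewrite (bigD1 i)//= big1 ?addr0 => [|j ji]; last first.
      have [/eqP/= fj|/(fd _ _ _ fi)ij] := boolP (f j x == 0); last by rewrite ij eqxx in ji.
      by rewrite [LHS](_ : _ = Num.sg (T (f j) z) * f j x)// fj mulr0.
    rewrite [X in `|X|](_ : _ = Num.sg (T (f i) z) * f i x)// normrM.
    rewrite mulr_ile1// ?normr_sg ?lern1 ?leq_b1//.
    by rewrite ger0_norm; have /andP[] := f01 i x.
  rewrite big1 ?normr0// => i _.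
  rewrite [LHS](_ : _ = Num.sg (T (f i) z) * f i x)//.
  by have [->|fi] := eqVneq (f i x) 0; rewrite ?mulr0//; case: nf; exists i.
have -> : \sum_i `|T (f i) z| = (T h) z.
  rewrite /h linear_sum sumCE; apply: eq_bigr => i _.
  by rewrite linearZ normrEsg.
rewrite (le_trans (ler_norm _))// (le_trans (supnorm_ub _ _))//.
by rewrite (le_trans (TM h))// ler_piMr.
Qed.

(** Summing [sum_disjoint_images] over [E], the total of all values is at most
    [M] times the size of [E], whatever the number of bumps; if there are many
    bumps, one of them has only small values on [E]. *)
Lemma small_image (T : {linear C R K -> C R L}) (M e : R) (E : set L) :
    (forall h, `|T h| <= M * `|h|) -> 0 <= M -> finite_set E -> 0 < e ->
  exists n, forall f : 'I_n -> C R K,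
    (forall i x, 0 <= f i x <= 1) ->
    (forall i j x, f i x != 0 -> f j x != 0 -> i = j) ->
  exists i, forall z, E z -> `|T (f i) z| <= e.
Proof.
move=> TM M0 /finite_seqP[s ->] e0.
pose n := (Num.truncn ((size s)%:R * M / e)).+1; exists n => f f01 fd.
have sn : (size s)%:R * M < n%:R * e by rewrite -ltr_pdivrMr// truncnS_gt.
apply: contrapT => nE.
have large (i : 'I_n) : e <= \sum_(z <- s) `|T (f i) z|.
  have [z [sz ez]] : exists z, z \in s /\ e < `|T (f i) z|.
    apply: contrapT => nz; apply: nE; exists i => z zs; rewrite leNgt.
    by apply/negP => ez; apply: nz; exists z.
  by rewrite (big_rem z)//= (le_trans (ltW ez))// lerDl sumr_ge0.
have : n%:R * e <= (size s)%:R * M.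
  rewrite -[n in n%:R]card_ord mulr_natl -sumr_const.
  apply: (le_trans (ler_sum _ (fun i _ => large i))); rewrite exchange_big/=.
  rewrite -count_predT mulr_natl -iter_addr_0 -big_const_seq.
  by apply: ler_sum => z _; exact: sum_disjoint_images.
by rewrite leNgt sn.
Qed.

Lemma small_bump (A W : set K) (T : {linear C R K -> C R L}) (M e : R)
    (E : set L) :
    open W -> A `<=` W -> infinite_set A ->
    (forall h, `|T h| <= M * `|h|) -> 0 <= M -> finite_set E -> 0 < e ->
  exists p (f : C R K), [/\ A p, forall x, 0 <= f x <= 1,
    \forall x \near p, f x = 1, forall x, ~ W x -> f x = 0 &
    forall z, E z -> `|T f z| <= e].
Proof.
move=> oW AW iA TM M0 fE e0.
have [n nP] := small_image T M e E TM M0 fE e0.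
have [p [f [Ap f01 f1 f0 fd]]] := disjoint_bumps A W n oW AW iA.
have [i iP] := nP f f01 fd.
exists (p i), (f i); split; [exact: Ap|exact: f01|exact: f1|exact: f0|exact: iP].
Qed.
End bumps.

(** * The quadratic inequality *)

Section lower_bound.
Context {R : realType} {K L : compactHausdorffType}.

Definition C_one : C R K := C_Sub (mem_set (@cst_continuous K R 1)).

(** The neighbourhoods of [w] being cofinite, continuous functions on [L] are
    close to their value at [w] off a finite set, and [small_bump] makes the
    images of the bumps small on such finite sets. *)
Lemma isomorphism_quadratic_bound (w : L) (T : {linear C R K -> C R L}) (M : R) :
    (cantor_bendixson 2%N : set K) !=set0 ->
    (forall U, nbhs w U -> finite_set (~` U)) ->
    (forall h, `|T h| <= M * `|h|) -> (forall h, `|h| <= `|T h|) ->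
    0 <= T C_one w -> 1 <= M /\ 0 <= M ^+ 2 - 4 * M - 1.
Proof.
move=> [x0 K2x0] cof TM Tm a0.
have hK := @hausdorff_spaceT K.
have one1 : `|C_one| <= 1 by apply: supnorm_le => // x; rewrite normr1.
have M1 : 1 <= M.
  have o1 : 1 <= `|C_one| by rewrite (le_trans _ (supnorm_ub C_one x0))//= normr1.
  have := le_trans (Tm C_one) (TM C_one); have -> : `|C_one| = 1 by apply/le_anti/andP.
  by rewrite mulr1.
split => //.
have M0 : 0 <= M by lra.
have pt (h : C R K) z : `|h| <= 1 -> `|T h z| <= M.
  by move=> h1; rewrite (le_trans (supnorm_ub (T h) z))// (le_trans (TM h))// ler_piMr.
pose a := T C_one w; rewrite -/a in a0.
have aM : a <= M by rewrite (le_trans (ler_norm _))// pt.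
(* The construction has an error [e]; the constant [D] only depends on [M]. *)
have [D D0 De] : exists2 D : R, 0 < D &
    forall e, 0 < e -> 0 <= M ^+ 2 - 4 * M - 1 + D * e; last first.
  apply/ler_addgt0Pr => e e0.
  by have := De (e / D) (divr_gt0 e0 D0); rewrite [D * _]mulrC divfK// gt_eqF.
exists (16 * M) => [|e e0]; first lra.
have cvgw (h : C R L) : \forall z \near w, `|h z - h w| <= e.
  have /cvgrPdist_le/(_ e e0) := @cts_fun _ _ (h : continuousType L R) w.
  by apply: filterS => z; rewrite distrC.
pose K1 : set K := cantor_bendixson 1%N.
(* A point of the second derivative makes the first one infinite. *)
have iK1 : infinite_set K1.
  rewrite -[K1]setIT.
  exact: (@limit_point_infinite _ K1 setT x0 hK K2x0 filterT).
pose U0 := [set z | `|T C_one z - a| <= e].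
have fE0 : finite_set (~` U0 `|` [set w]).
  by rewrite finite_setU; split; [exact/cof/cvgw|exact: finite_set1].
have [p [f [K1p f01 f1 _ Tf]]] := small_bump K1 setT T M e _ openT
  (@subsetT _ _) iK1 TM M0 fE0 e0.
pose W := [set x | f x = 1]^°.
(* [p] is a limit point of the whole space, so that there is room for [g]. *)
have iW : infinite_set W.
  rewrite -[W]setTI; apply: (@limit_point_infinite _ setT W p hK K1p).
  exact: nbhs_interior.
pose U1 := [set z | `|T f z - T f w| <= e].
have fE1 : finite_set (~` U0 `|` ~` U1).
  by rewrite finite_setU; split; exact/cof/cvgw.
have [q [g [Wq g01 g1 gW Tg]]] := small_bump W W T M e _ (open_interior _)
  (@subset_refl _ _) iW TM M0 fE1 e0.
have gf x : g x != 0 -> f x = 1.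
  by apply: contra_neqP => fx; apply: gW => /interior_subset.
have gq : g q = 1 by exact: nbhs_singleton g1.
have fq : f q = 1 by exact: interior_subset Wq.
have TE (b c d : R) z : T (b *: C_one + c *: f + d *: g) z =
    b * T C_one z + c * T f z + d * T g z.
  by rewrite !linearD !linearZ.
have hE (b c d : R) x : (b *: C_one + c *: f + d *: g) x = b + c * f x + d * g x.
  by rewrite -[b in RHS]mulr1.
(* Where [g] is not 0 the function [f] is 1, so that 1 - 2f + 2g is 2g - 1. *)
have unit_ball (c d : R) :
    c = -2 /\ d = 0 \/ c = 0 /\ d = -2 \/ c = -2 /\ d = 2 ->
    `|1 *: C_one + c *: f + d *: g| <= 1.
  move=> cd; apply: supnorm_le => // x; rewrite hE ler_norml.
  have /andP[f0 fl] := f01 x; have /andP[g0 gl] := g01 x.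
  have [gx|/gf ->] := eqVneq (g x) 0.
    by rewrite gx; move: cd => [[-> ->]|[[-> ->]|[-> ->]]]; apply/andP; split; lra.
  by move: cd => [[-> ->]|[[-> ->]|[-> ->]]]; apply/andP; split; lra.
have hz z : value_constraints M a e (T C_one z) (T f z) (T g z).
  split; [split=> //; first exact: ltW|].
    split; first exact: pt.
    - have := pt _ z (unit_ball (-2) 0 ltac:(by left)); rewrite TE.
      by congr (`|_| <= _); ring.
    - have := pt _ z (unit_ball 0 (-2) ltac:(by right; left)); rewrite TE.
      by congr (`|_| <= _); ring.
    - have := pt _ z (unit_ball (-2) 2 ltac:(by right; right)); rewrite TE.
      by congr (`|_| <= _); ring.
  have [U0z|nU0z] := pselect (U0 z); last first.
    by apply: Or31; split; [apply: Tf; left|apply: Tg; left].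
  have [U1z|nU1z] := pselect (U1 z); last by apply: Or32; split => //; apply: Tg; right.
  apply: Or33; split => //; rewrite -(subrK (T f w) (T f z)).
  rewrite (le_trans (ler_normD _ _))// mulr_natl mulr2n lerD//.
  by apply: Tf; right.
(* At [q] the three functions are 1, and [T] does not decrease norms. *)
have lower (b c d B : R) : 0 <= B ->
    (forall z, `|b * T C_one z + c * T f z + d * T g z| <= B) -> b + c + d <= B.
  move=> B0 hB; set h := b *: C_one + c *: f + d *: g.
  have -> : b + c + d = h q by rewrite hE fq gq !mulr1.
  rewrite (le_trans (ler_norm _))// (le_trans (supnorm_ub h q))//.
  rewrite (le_trans (Tm h))//; apply: supnorm_le => // z.
  by rewrite TE.
have Me : 0 <= M * e by rewrite mulr_ge0// ltW.
have MM : 0 <= M * (M + a) by rewrite mulr_ge0//; lra.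
have aMM : 0 <= (M - a) * (M + a) by rewrite mulr_ge0//; lra.
have := lower (M + a) (2 * (M - a)) (2 * (M + a)) _ _
  (fun z => image_bound_of_three_terms _ _ _ _ _ _ (hz z)).
move=> /(_ ltac:(lra)) est1.
have := lower 0 (M - a) (M + a) ((M ^+ 2 - a ^+ 2) / 2 + 7 * M * e).
move=> /(_ ltac:(lra)) est2.
have {}est2 : 2 * M <= (M ^+ 2 - a ^+ 2) / 2 + 7 * M * e.
  have -> : 2 * M = 0 + (M - a) + (M + a) by ring.
  apply: est2 => z; rewrite mul0r add0r.
  exact: image_bound_of_two_terms _ _ _ _ _ _ (hz z).
have [a1|a1] := leP a 1.
  have : 0 <= (1 - a) * (M - 1) by rewrite mulr_ge0//; lra.
  lra.
have : 0 <= (a - 1) * (a + 1) by rewrite mulr_ge0//; lra.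
lra.
Qed.
End lower_bound.

(** * The space [0,omega] and operator norms *)

Lemma cofinite_nbhs_omega (U : set (order_topology succ_omega)) :
  nbhs (None : order_topology succ_omega) U -> finite_set (~` U).
Proof.
have ltE (x y : order_topology succ_omega) : (x < y)%O = ~~ le_succ_omega y x.
  by rewrite ltNge.
have le_omega x : le_succ_omega x None = true by case: x.
rewrite itv_nbhsE => -[[l r] [oi omega_lr] sU].
have [n nlr] : exists n, forall m, (n < m)%N ->
    (Some m : order_topology succ_omega) \in Interval l r.
  case: r oi omega_lr {sU} => [b r|[]] oi; rewrite in_itv/= ?andbF//.
    by rewrite (itv_open_ends_rside oi) /= ltE le_omega andbF.
  case: l oi => [b [n|]|[]] oi //; rewrite ?andbT.
  - by exists n => m nm; rewrite in_itv/= andbT lteifS// ltE/= -ltnNge.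
  - by rewrite (itv_open_ends_lside oi)/= ltxx.
  - by exists 0%N => m _; rewrite in_itv.
apply: (@sub_finite_set _ _ (Some @` `I_n.+1)); last first.
  by apply: finite_image; exact: finite_II.
case=> [m|] nU; last by case: nU; exact: sU.
by exists m => //=; rewrite ltnS leqNgt; apply/negP => /nlr /sU.
Qed.

Lemma opnorm_bound {R : realType} {X Y : normedModType R} (T : {linear X -> Y}) :
  bounded_linear T ->
  exists2 A : R, opnorm T = A%:E & 0 <= A /\ forall x, `|T x| <= A * `|x|.
Proof.
rewrite /bounded_linear => Tb.
have ub x : `|x| <= 1 -> (`|T x|%:E <= opnorm T)%E.
  by move=> x1; apply: ereal_sup_ubound; exists x.
have T0 : (0 <= opnorm T)%E by have := ub 0; rewrite normr0 linear0 normr0; apply.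
have fT : opnorm T \is a fin_num by rewrite ge0_fin_numE.
exists (fine (opnorm T)); first by rewrite fineK.
split=> [|x]; first exact: fine_ge0.
have [->|x0] := eqVneq x 0; first by rewrite linear0 !normr0 mulr0.
have nx : 0 < `|x| by rewrite normr_gt0.
rewrite -ler_pdivrMr// -lee_fin fineK//.
have -> : `|T x| / `|x| = `|T (`|x|^-1 *: x)|.
  by rewrite linearZ normrZ normfV normr_id mulrC.
by apply: ub; rewrite normrZ normfV normr_id mulVf// gt_eqF.
Qed.

Theorem theorem4p1 (R : realType) (K : compactHausdorffType)
    (hK : (cantor_bendixson 2%N : set K) !=set0) :
  ((2 + Num.sqrt 5)%:E <= d_BM (C R K) (C R (order_topology succ_omega)))%E.
Proof.
apply: le_ereal_inf_tmp => _ [T [S [[Tb Sb TS ST] ->]]].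
have [A -> [A0 TA]] := opnorm_bound T Tb.
have [B -> [B0 SB]] := opnorm_bound S Sb.
rewrite -EFinM lee_fin.
(* [c] scales [T] by the norm of its inverse and makes the value at omega
   nonnegative. *)
have [c [cB aw]] : exists c : R, `|c| = B /\ 0 <= (c *: T C_one) None.
  have [Tp|Tn] := leP 0 (T C_one None).
    by exists B; split; [rewrite ger0_norm|exact: mulr_ge0].
  exists (- B); split; first by rewrite normrN ger0_norm.
  by rewrite [leRHS](_ : _ = - B * T C_one None)// mulNr -mulrN mulr_ge0// oppr_ge0 ltW.
have TcE h : `|(c \*: T) h| = B * `|T h| by rewrite -cB -normrZ.
have [||M1 M2] := isomorphism_quadratic_bound
  (None : order_topology succ_omega) (c \*: T) (A * B) hK cofinite_nbhs_omega
  _ _ aw.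
- by move=> h; rewrite TcE [A * B]mulrC -mulrA ler_wpM2l.
- by move=> h; rewrite TcE -{1}(TS h) SB.
have s5 : Num.sqrt 5 ^+ 2 = 5 :> R by rewrite sqr_sqrtr.
have s1 : 1 < Num.sqrt 5 :> R by rewrite -[ltLHS]sqrtr1 ltr_sqrt ?ltr1n.
rewrite leNgt; apply/negP => lt_M.
(* M^2 - 4M - 1 = (M - 2)^2 - 5 is negative between 2 - sqrt 5 and 2 + sqrt 5. *)
have : 0 < (2 + Num.sqrt 5 - A * B) * (A * B - 2 + Num.sqrt 5).
  by rewrite mulr_gt0//; lra.
lra.
Qed.
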